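(* For any $d$-regular bipartite graph $G=(V,E)$ with $\nu(G)=d-\sqrt d$ and any maximal magnetic potential $\sigma$ on $G$, the graph $G$ satisfies $CD^\sigma(0,\infty)$. Moreover: (a) Let $x\in V$. If all vertices $z\in V$ at distance $2$ from $x$ have precisely $2$ common neighbours with $x$, the $\sigma$-curvature vanishes, that is, $K^\sigma_\infty(x)=0$. (b) Let $x\in V$. If all vertices $z\in V$ at distance $2$ from $x$ have at least $b\ge 3$ common neighbours with $x$, then the $\sigma$-curvature is strictly positive and satisfies $$K_\infty^\sigma(x)\ \ge\ \min\left\{2,\ d\left(1-\frac{2}{b}\right)\right\}.$$ Moreover, this inequality holds with equality if all vertices $z\in V$ at distance $2$ from $x$ have precisely $b\ge 3$ common neighbours with $x$. In particular, all hypercubes are $\sigma$-flat (that is, $K_\infty^\sigma\equiv 0$), and all complete bipartite graphs $K_{d,d}$, $d\ge 3$, have constant positive $\sigma$-curvature $K_\infty^\sigma\equiv 1$ for $d=3$ and $K_\infty^\sigma\equiv 2$ for $d\ge 4$.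
   Context: All graphs $G=(V,E)$ are finite and simple (no loops, no multiple edges); $x\sim y$ denotes adjacency. $E^{or}(G)$ is the set of ordered pairs $(x,y)$ with $x\sim y$. A magnetic potential is a map $\sigma:E^{or}(G)\to S^1=\{z\in\mathbb{C}:|z|=1\}$ with $\sigma(y,x)=\sigma(x,y)^{-1}$. The magnetic Laplacian on functions $f:V\to\mathbb{C}$ is $\Delta^\sigma f(x)=\sum_{y\sim x}(f(x)-\sigma(x,y)f(y))$; $\Delta$ denotes the case $\sigma\equiv 1$. $\lambda_1^\sigma(G)\ge 0$ is the smallest eigenvalue of $\Delta^\sigma$. The magneto-spectral height is $\nu(G)=\sup_\sigma\lambda_1^\sigma(G)$, over all magnetic potentials; $\sigma$ is maximal if $\lambda_1^\sigma(G)=\nu(G)$. Magnetic Bakry-Émery curvature: for $f,g:V\to\mathbb{C}$, $$2\Gamma^\sigma(f,g)(x)=-\Delta(f\bar g)(x)+f(x)\overline{\Delta^\sigma g(x)}+\Delta^\sigma f(x)\overline{g(x)}=\sum_{y\sim x}(f(x)-\sigma(x,y)f(y))\overline{(g(x)-\sigma(x,y)g(y))},$$ $$2\Gamma_2^\sigma(f,g)(x)=-\Delta\Gamma^\sigma(f,g)(x)+\Gamma^\sigma(f,\Delta^\sigma g)(x)+\Gamma^\sigma(\Delta^\sigma f,g)(x).$$ For $K\in\mathbb{R}$, $G$ satisfies $CD^\sigma(K,\infty)$ at $x$ if $\Gamma_2^\sigma(f,f)(x)\ge K\,\Gamma^\sigma(f,f)(x)$ for all $f:V\to\mathbb{C}$;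 it satisfies $CD^\sigma(K,\infty)$ if this holds at all vertices. The $\sigma$-curvature $K^\sigma_\infty(x)$ is the supremum of all $K\in\mathbb{R}$ such that $CD^\sigma(K,\infty)$ holds at $x$. The $d$-dimensional hypercube is $Q^d=(K_2)^d$ (Cartesian power); in the final consequences $\sigma$ denotes any maximal magnetic potential of the respective graph.
   Formalization: Part (a), the equality clause of (b), and flatness of hypercubes are stated for d ≥ 2; for d ≤ 1 no vertex lies at distance 2 and these claims fail (K_2 = Q^1 has ν = 0 and σ-curvature 2; for d = 0 the curvature is +∞). *)

(* Defs.v *)
From HB Require Import structures.
From mathcomp Require Import all_boot all_order all_algebra.
From mathcomp Require Import complex.
From mathcomp Require Import boolp classical_sets reals constructive_ereal ereal.

Set Implicit Arguments.
Unset Strict Implicit.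
Unset Printing Implicit Defensive.

Import Order.TTheory GRing.Theory Num.Theory.
Local Open Scope classical_set_scope.
Local Open Scope ring_scope.
Local Open Scope complex_scope.

Section Graphs.
Variables (V : finType) (e : rel V).

Definition simple_graph : Prop := symmetric e /\ irreflexive e.

Definition regular (d : nat) : Prop := forall x, #|[set y | e x y]%SET| = d.

Definition bipartite : Prop :=
  exists c : V -> bool, forall x y, e x y -> c x != c y.

Definition walk (n : nat) (x z : V) : Prop :=
  exists p : seq V, [/\ size p = n, path e x p & last x p = z].

Definition at_distance (n : nat) (x z : V) : Prop :=
  walk n x z /\ forall m : nat, (m < n)%N -> ~ walk m x z.

Definition common_neighbours (x z : V) : nat :=
  #|[set y | e x y && e z y]%SET|.

(* The Cartesian power: exactly one coordinate moves, along an edge. *)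
Definition cartesian_power (d : nat) : rel {ffun 'I_d -> V} :=
  fun u v => [exists i, e (u i) (v i) &&
                        [forall j, (j != i) ==> (u j == v j)]].

End Graphs.

Arguments cartesian_power {V} e d.

Definition complete_graph (V : finType) : rel V := fun x y => x != y.
Arguments complete_graph : clear implicits.

Definition hypercube (d : nat) : rel {ffun 'I_d -> bool} :=
  cartesian_power (complete_graph bool) d.
Arguments hypercube : clear implicits.

Definition complete_bipartite (m n : nat) : rel ('I_m + 'I_n)%type :=
  fun x y => match x, y with
             | inl _, inr _ | inr _, inl _ => true
             | _, _ => false
             end.
Arguments complete_bipartite : clear implicits.

Section MagneticLaplacian.
Variables (R : realType) (V : finType) (e : rel V).
Implicit Types (s : V -> V -> R[i]) (f g : V -> R[i]).

(* A potential lives on oriented edges only: the values of [s] on non-adjacent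
   pairs are unconstrained and never used. *)
Definition magnetic_potential s : Prop :=
  forall x y, e x y -> `|s x y| = 1 /\ s y x = (s x y)^-1.

Definition magnetic_laplacian s f : V -> R[i] :=
  fun x => \sum_(y | e x y) (f x - s x y * f y).

Definition laplacian f : V -> R[i] := magnetic_laplacian (fun _ _ => 1) f.

Definition laplacian_eigenvalue s (a : R[i]) : Prop :=
  exists f, (exists x, f x != 0) /\
            forall x, magnetic_laplacian s f x = a * f x.

(* When [e] is symmetric and [s] is a potential, the magnetic Laplacian is
   Hermitian, so its eigenvalues are real; for nonempty [V] they form a finite
   nonempty set and the infimum below is a minimum. *)
Definition lambda1 s : R := inf [set t : R | laplacian_eigenvalue s t%:C].

Definition magneto_spectral_height : R :=
  sup [set lambda1 s | s in magnetic_potential].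

Definition maximal_potential s : Prop :=
  magnetic_potential s /\ lambda1 s = magneto_spectral_height.

Definition Gamma s f g : V -> R[i] := fun x =>
  (- laplacian (fun y => f y * (g y)^*) x
   + f x * (magnetic_laplacian s g x)^*
   + magnetic_laplacian s f x * (g x)^*) / 2.

Definition Gamma2 s f g : V -> R[i] := fun x =>
  (- laplacian (Gamma s f g) x
   + Gamma s f (magnetic_laplacian s g) x
   + Gamma s (magnetic_laplacian s f) g x) / 2.

(* [Gamma s f f x] and [Gamma2 s f f x] are real, so the order of [R[i]]
   (equal imaginary parts, ordered real parts) compares them as reals. *)
Definition CD_at s (K : R) (x : V) : Prop :=
  forall f, K%:C * Gamma s f f x <= Gamma2 s f f x.

Definition CD s (K : R) : Prop := forall x, CD_at s K x.

(* Extended-real valued: at an isolated vertex every [K] is admissible and the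
   curvature is [+oo]. *)
Definition curvature s (x : V) : \bar R :=
  ereal_sup [set K%:E | K in [set K : R | CD_at s K x]].

End MagneticLaplacian.

Arguments magneto_spectral_height R {V} e.

(* Main.v *)
Require Import Defs.
From HB Require Import structures.
From mathcomp Require Import all_boot all_order all_algebra.
From mathcomp Require Import complex.
From mathcomp Require Import boolp classical_sets reals constructive_ereal ereal.
From mathcomp Require Import ring spectral sesquilinear cyclic separable cyclotomic.

Set Implicit Arguments.
Unset Strict Implicit.
Unset Printing Implicit Defensive.

Import Order.TTheory GRing.Theory Num.Theory.
Local Open Scope ring_scope.

(** Write [A] for the magnetic adjacency operator, so that on a [d]-regular
graph the magnetic Laplacian is [d - A].

The spectral hypothesis forces [A^2 = d]. Indeed the smallest eigenvalue of
[d - A] being at least [d - sqrt d] bounds the eigenvalues of [A] above by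
[sqrt d]; on a bipartite graph the spectrum of [A] is symmetric, so all
eigenvalues have square at most [d]; and the trace of [A^2] counts closed walks
of length two, so these squares have mean exactly [d]. Hence they all equal [d]
([adjacency_sqr_of_lambda1]). The converse implication holds as well
([lambda1_of_adjacency_sqr]), so [d - sqrt d] is an upper bound for [lambda1],
and one potential with [A^2 = d] makes the square of the adjacency operator of
every maximal potential equal to [d] ([maximal_adjacency_sqr]). This handles
the two families: signs (as in Huang's signed cubes) for the hypercube, and the
discrete Fourier matrix for the complete bipartite graph.

When [A^2 = d], the form [Gamma2] at [x] becomes explicit. Let
[u y = f x - s x y * f y] for the neighbours [y] of [x], with sum [U] and sum of
squared moduli [N], so that [Gamma f f x = N / 2]. Put [g y = s y x * u y] on
the neighbours of [x] and [0] elsewhere, [T = A g], and let [c z] be the number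
of common neighbours of [x] and [z]. Then [T x = U], and [A^2 = d] gives that
the squared moduli of [T] sum to [d N]. The value [4 Gamma2 f f x] is the sum of
a form in [f x], [U] and [N] and of the terms
[c z |f z|^2 + 4 Re (conj (f z) * T z)] over [z != x] ([Gamma2E]). Completing
the squares in [f x] and in each [f z] leaves
[2 d (1 - 2/b) (N - |U|^2/d) + (4/d) |U|^2] as a lower bound if all nonzero
[c z] with [z != x] are at least [b]. If they are all equal to [b], the bound is
attained: there are no triangles, so only vertices at distance two contribute to
the sum, and there, as at [x], the values of [f] are free once [u] is given. The
two summands [N - |U|^2/d] and [|U|^2/d] of [N] are nonnegative, so the best
constant is [min (2, d (1 - 2/b))]: the value [2] is attained by [u] constant,
the other one by a nonzero [u] of zero sum, which exists for [d >= 2]. Finally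
[A^2 = d] excludes [c z = 1], so that [b = 2] is always allowed, which gives
nonnegative curvature. *)

(** * The magnetic adjacency operator *)

Section Adjacency.
Variables (R : realType) (V : finType) (e : rel V) (s : V -> V -> R[i]).
Implicit Types (f g : V -> R[i]) (x y z : V).

Definition magnetic_adjacency f : V -> R[i] :=
  fun x => \sum_(y | e x y) s x y * f y.
Local Notation A := magnetic_adjacency.

Definition adjacency_squares_to (d : nat) : Prop :=
  forall f x, A (A f) x = d%:R * f x.

Hypotheses (e_sym : symmetric e) (s_pot : magnetic_potential e s).

Lemma potential_inv x y : e x y -> s x y * s y x = 1.
Proof.
move=> exy; have [s1 ->] := s_pot exy.
by rewrite divff // -normr_eq0 s1 oner_eq0.
Qed.

Lemma potential_conj x y : e x y -> (s x y)^* = s y x.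
Proof.
move=> exy; have [s1 ->] := s_pot exy.
by rewrite invC_norm s1 expr1n invr1 mul1r.
Qed.

Lemma adjacency_selfadjoint f g :
  \sum_x A f x * (g x)^* = \sum_x f x * (A g x)^*.
Proof.
under eq_bigr do rewrite big_distrl /=.
under [RHS]eq_bigr do rewrite rmorph_sum big_distrr /=.
rewrite (exchange_big_dep xpredT) //=; apply: eq_bigr => y _.
apply: eq_big => [x|x exy]; first exact: e_sym.
by rewrite rmorphM /= potential_conj 1?e_sym //; ring.
Qed.

Variable d : nat.
Hypothesis e_reg : regular e d.

Lemma sum_nbr_const x (c : R[i]) : \sum_(y | e x y) c = d%:R * c.
Proof. by rewrite sumr_const -cardsE e_reg mulr_natl. Qed.

Lemma laplacian_adjacency f x :
  magnetic_laplacian e s f x = d%:R * f x - A f x.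
Proof. by rewrite /magnetic_laplacian sumrB sum_nbr_const. Qed.

(** Expanding each edge term, [|s x y| = 1] turns the boundary contribution
[f y * (g y)^*] into the missing term of the product. *)
Lemma GammaE f g x :
  Gamma e s f g x =
  (\sum_(y | e x y) (f x - s x y * f y) * (g x - s x y * g y)^*) / 2.
Proof.
rewrite /Gamma /laplacian /magnetic_laplacian; congr (_ / 2).
rewrite rmorph_sum /= mulr_sumr mulr_suml -sumrN -!big_split /=.
apply: eq_bigr => y exy.
have : s x y * (s x y)^* = 1 by rewrite potential_conj // potential_inv.
rewrite !(rmorphB, rmorphM) /= => h.
by ring: h.
Qed.

End Adjacency.

(** * The curvature form when the adjacency operator squares to the degree *)

Section CurvatureForm.
Variables (R : realType) (V : finType) (e : rel V) (s : V -> V -> R[i]).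
Variable d : nat.
Hypotheses (e_simple : simple_graph e) (e_reg : regular e d).
Hypotheses (s_pot : magnetic_potential e s).
Local Notation A := (magnetic_adjacency e s).
Hypothesis s_sqr : adjacency_squares_to e s d.

Let e_sym : symmetric e := e_simple.1.

Implicit Types (f u : V -> R[i]) (x y z : V).

(** Transports to the neighbours of [x] a function that has been gauged to [x]:
if [u y = s x y * h y] for the neighbours [y] of [x], the result is [h]
restricted to them. *)
Definition star_lift x u : V -> R[i] := fun y => if e x y then s y x * u y else 0.

Local Notation T := (fun x u => A (star_lift x u)).

Lemma adjacency_star_lift_center x u : T x u x = \sum_(y | e x y) u y.
Proof.
apply: eq_bigr => y exy; rewrite /star_lift exy mulrA.
by rewrite (potential_inv s_pot) ?mul1r.
Qed.

Lemma adjacency_star_lift_far x u z : common_neighbours e x z = 0%N -> T x u z = 0.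
Proof.
move=> /eqP; rewrite cards_eq0 => /eqP/setP c0; apply: big1 => y ezy.
rewrite /star_lift; case: ifP => [exy|_]; last by rewrite mulr0.
by have := c0 y; rewrite !inE exy ezy.
Qed.

(** Up to the factor [d] the operator [A] is an isometry, being self-adjoint with
square [d]. *)
Lemma sum_adjacency_star_lift x u :
  \sum_z T x u z * (T x u z)^* = d%:R * \sum_(y | e x y) u y * (u y)^*.
Proof.
rewrite (adjacency_selfadjoint e_sym s_pot) mulr_sumr [RHS]big_mkcond /=.
apply: eq_bigr => y _; rewrite s_sqr /star_lift; case: ifP => exy; last by rewrite mul0r.
have h : s y x * s x y = 1 by rewrite (potential_inv s_pot) // e_sym.
rewrite !rmorphM /= (potential_conj s_pot) 1?e_sym // conjC_nat.
by ring: h.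
Qed.

Lemma sum_two_steps x (g : V -> R[i]) :
  \sum_(y | e x y) \sum_(z | e y z) g z =
  \sum_z (common_neighbours e x z)%:R * g z.
Proof.
rewrite (exchange_big_dep xpredT) //=; apply: eq_bigr => z _.
rewrite sumr_const mulr_natl /common_neighbours cardsE; congr (_ *+ _).
by apply: eq_card => y; rewrite unfold_in [e y z]e_sym.
Qed.

Lemma common_neighbours_diag x : common_neighbours e x x = d.
Proof.
by rewrite -(e_reg x); apply: eq_card => y; rewrite !inE andbb.
Qed.

(** The relation [A (A f) x = d * f x] removes the mixed terms between [f x] and
the values of [f] at distance two. In the last sum the term at [z] involves only
[f z] and the value at [z] of a function determined by [u]; it vanishes when [x]
and [z] have no common neighbour. *)
Lemma Gamma2E f x (u := fun y => f x - s x y * f y)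
    (U := \sum_(y | e x y) u y) :
  4 * Gamma2 e s f f x =
    2 * d%:R * (\sum_(y | e x y) u y * (u y)^*)
    + d%:R * (d%:R - 1) * (f x * (f x)^*)
    - 2 * (d%:R - 1) * (U * (f x)^* + U^* * f x)
    + 2 * (U * U^*)
    + \sum_(z | z != x)
       ((common_neighbours e x z)%:R * (f z * (f z)^*)
        + 2 * ((f z)^* * T x u z + f z * (T x u z)^*)).
Proof.
set N := \sum_(y | e x y) u y * (u y)^*.
(* [P y] is [A f] at [y] gauged to [x]; by [A^2 = d] it sums to [d * f x]. *)
pose P y := s x y * A f y.
have Afx : A f x = d%:R * f x - U.
  by rewrite /U /u sumrB (sum_nbr_const e_reg) opprB addrCA subrr addr0.
have sumP : \sum_(y | e x y) P y = d%:R * f x by rewrite -s_sqr.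
pose W := \sum_(y | e x y) u y * (P y)^*.
have WE : W = \sum_z (f z)^* * T x u z.
  under eq_bigr do rewrite mulrC.
  rewrite (adjacency_selfadjoint e_sym s_pot) [LHS]big_mkcond /=.
  apply: eq_bigr => y _; rewrite /star_lift; case: ifP => exy; last by rewrite mul0r.
  by rewrite /P rmorphM /= (potential_conj s_pot) //; ring.
pose Z := \sum_(y | e x y) \sum_(z | e y z) f z * (f z)^*.
(* The term [z = x] is put back: there the count is [d] and [T] is [U]. *)
have -> : \sum_(z | z != x) ((common_neighbours e x z)%:R * (f z * (f z)^*)
        + 2 * ((f z)^* * T x u z + f z * (T x u z)^*))
   = Z + 2 * (W + W^*) - (d%:R * (f x * (f x)^*) + 2 * ((f x)^* * U + f x * U^*)).
  rewrite /Z sum_two_steps WE rmorph_sum /= -big_split /= mulr_sumr -big_split /=.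
  rewrite [X in _ = X - _](bigD1 x) //= common_neighbours_diag.
  rewrite adjacency_star_lift_center -/U.
  rewrite !rmorphM /= conjCK [RHS]addrAC subrr add0r.
  by apply: eq_bigr => z _; rewrite rmorphM /= conjCK.
(* Edgewise expansion of [Gamma2], with [s x y * f y] replaced by [f x - u y]. *)
have -> : 4 * Gamma2 e s f f x =
  \sum_(y | e x y)
    (d%:R * (f x * (f x)^*) - d%:R * (f x * (u y)^* + (f x)^* * u y)
     + 2 * d%:R * (u y * (u y)^*) - (f x * (P y)^* + (f x)^* * P y)
     + 2 * (u y * (P y)^* + (u y)^* * P y) - (u y * (A f x)^* + (u y)^* * A f x))
  + Z.
  have GE y : Gamma e s f f y =
      (d%:R * (f y * (f y)^*) - (f y * (A f y)^* + A f y * (f y)^*)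
       + \sum_(z | e y z) f z * (f z)^*) / 2.
    rewrite (GammaE s_pot) -(sum_nbr_const e_reg y) /magnetic_adjacency.
    rewrite rmorph_sum /=; congr (_ / 2).
    rewrite mulr_sumr mulr_suml -big_split /= -sumrB -big_split /=.
    apply: eq_bigr => z eyz.
    have h : s y z * (s y z)^* = 1.
      by rewrite (potential_conj s_pot) // (potential_inv s_pot).
    by rewrite !(rmorphB, rmorphM) /=; ring: h.
  rewrite /Gamma2 /laplacian {1}/magnetic_laplacian sumrB (sum_nbr_const e_reg).
  under [in LHS]eq_bigr do rewrite mul1r GE.
  rewrite !(GammaE s_pot f _ x) !(GammaE s_pot _ f x).
  rewrite -mulr_suml.
  set S1 := \sum_(y | e x y) _; set S2 := \sum_(y | e x y) _.
  set S3 := \sum_(y | e x y) _; set S4 := \sum_(y | e x y) _.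
  transitivity (S2 - d%:R * S1 + S3 + S4); first by field.
  rewrite /S1 /S2 /S3 /S4 big_split /= mulr_sumr -sumrN -/Z.
  rewrite [LHS](AC (2*1*1*1) (1*3*4*5*2)) /=; congr (_ + _).
  rewrite -!big_split /=.
  apply: eq_bigr => y exy.
  rewrite !(laplacian_adjacency _ e_reg) /u /P.
  have h : s x y * (s x y)^* = 1.
    by rewrite (potential_conj s_pot) // (potential_inv s_pot).
  by rewrite !(rmorphB, rmorphM) /= !conjC_nat; ring: h.
(* [u] is made opaque so that the sums of its values are not split further. *)
clearbody u.
have conjW : \sum_(y | e x y) (u y)^* * P y = W^*.
  by rewrite rmorph_sum; apply: eq_bigr => y _; rewrite rmorphM /= conjCK.
rewrite !(sumrB, big_split, =^~ mulr_sumr, =^~ mulr_suml) /= (sum_nbr_const e_reg).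
rewrite -!rmorph_sum /= conjW sumP -/U -/W -/N Afx !(rmorphB, rmorphM) /= conjC_nat.
by ring.
Qed.

End CurvatureForm.

(** * Optimal curvature constants *)

Section CurvatureBounds.
Variables (R : realType) (V : finType) (e : rel V) (s : V -> V -> R[i]).
Variable d : nat.
Hypotheses (e_simple : simple_graph e) (e_reg : regular e d).
Hypotheses (s_pot : magnetic_potential e s).
Local Notation A := (magnetic_adjacency e s).
Hypothesis s_sqr : adjacency_squares_to e s d.

Let e_sym : symmetric e := e_simple.1.

Implicit Types (f u : V -> R[i]) (x y z : V).

Local Notation T := (fun x u => A (star_lift e s x u)).

(** The coefficient of [A^2] at two distinct vertices is the sum over their
common neighbours of products of unit complex numbers. It has to vanish, which a
single such product does not. *)
Lemma common_neighbours_ge2 x z :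
  z != x -> common_neighbours e x z != 0%N -> (2 <= common_neighbours e x z)%N.
Proof.
move=> zx; case cE : (common_neighbours e x z) => [|[|n]] // _.
have /eqP/cards1P[y /setP yE] := cE.
have := yE y; rewrite !inE eqxx => /andP[exy ezy].
have /esym/eqP := s_sqr (fun v => (v == z)%:R) x.
rewrite eq_sym in zx; rewrite (negPf zx) mulr0 {1}/magnetic_adjacency (bigD1 y) //=.
rewrite [X in _ + X]big1 => [|w /andP[exw wy]]; last first.
  rewrite /magnetic_adjacency big1 ?mulr0 // => v ewv.
  case: eqVneq ewv => [->|_ _]; last by rewrite mulr0.
  by have := yE w; rewrite !inE exw e_sym (negPf wy) /= => ->.
rewrite addr0 /magnetic_adjacency (bigD1 z) 1?e_sym //= eqxx mulr1 big1 ?addr0.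
  have [s1 _] := s_pot exy; have [s2 _] := s_pot ezy.
  rewrite eq_sym mulf_eq0 -normr_eq0 s1 oner_eq0 /= -normr_eq0 -norm_conjC.
  by rewrite (potential_conj s_pot) 1?e_sym // s2 oner_eq0.
by move=> v /andP[_ /negPf ->]; rewrite mulr0.
Qed.

(** The square in [f x] is completed here. The squares in the [f z] use the
number [b]: [4 / b * |T z|^2] is added to each term, and by the isometry property
these amount in total to [4 / b * (d * N - |U|^2)]. *)
Lemma Gamma2_squares b f x (u := fun y => f x - s x y * f y)
    (U := \sum_(y | e x y) u y)
    (N := \sum_(y | e x y) u y * (u y)^*) :
  (0 < d)%N -> (0 < b)%N ->
  4 * Gamma2 e s f f x =
    2 * (d%:R * (1 - 2 / b%:R)) * (N - U * U^* / d%:R) + 4 / d%:R * (U * U^*)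
    + d%:R * (d%:R - 1) * ((f x - 2 / d%:R * U) * (f x - 2 / d%:R * U)^*)
    + \sum_(z | z != x)
       ((common_neighbours e x z)%:R * (f z * (f z)^*)
        + 2 * ((f z)^* * T x u z + f z * (T x u z)^*)
        + 4 / b%:R * (T x u z * (T x u z)^*)).
Proof.
move=> d0 b0.
have dn0 : d%:R != 0 :> R[i] by rewrite pnatr_eq0 -lt0n.
have bn0 : b%:R != 0 :> R[i] by rewrite pnatr_eq0 -lt0n.
rewrite (Gamma2E e_simple e_reg s_pot s_sqr) -/u [in RHS]big_split /= -[in RHS]mulr_sumr.
have -> : \sum_(z | z != x) T x u z * (T x u z)^* = d%:R * N - U * U^*.
  have := sum_adjacency_star_lift e_simple s_pot s_sqr x u.
  rewrite (bigD1 x) //= (adjacency_star_lift_center s_pot) -/U -/N => <-.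
  by rewrite addrC addrK.
rewrite -/U -/N; clearbody u.
rewrite !(rmorphB, rmorphM, fmorphV) /= !conjC_nat.
by field; rewrite dn0 bn0.
Qed.

(** Shows that the terms of the last sum in [Gamma2_squares] are nonnegative if
[b <= c], and vanish for a suitable [w] if [b = c]. *)
Lemma square_completion (c b : nat) (w t : R[i]) : (0 < b)%N ->
  c%:R * (w * w^*) + 2 * (w^* * t + w * t^*) + 4 / b%:R * (t * t^*) =
  (c%:R - b%:R) * (w * w^*) + b%:R * ((w + 2 / b%:R * t) * (w + 2 / b%:R * t)^*).
Proof.
move=> b0; have bn0 : b%:R != 0 :> R[i] by rewrite pnatr_eq0 -lt0n.
by rewrite !(rmorphD, rmorphM, fmorphV) /= !conjC_nat; field.
Qed.

(** This is [d] times the variance of [u] on the neighbours of [x]. *)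
Lemma sum_nbr_variance x u (U := \sum_(y | e x y) u y) : (0 < d)%N ->
  0 <= (\sum_(y | e x y) u y * (u y)^*) - U * U^* / d%:R.
Proof.
move=> d0; have dn0 : d%:R != 0 :> R[i] by rewrite pnatr_eq0 -lt0n.
have -> : (\sum_(y | e x y) u y * (u y)^*) - U * U^* / d%:R =
          \sum_(y | e x y) (u y - U / d%:R) * (u y - U / d%:R)^*.
  under [RHS]eq_bigr do
    rewrite rmorphB mulrBl !mulrBr opprB.
  rewrite !(sumrB, big_split) /= (sum_nbr_const e_reg) -mulr_suml -mulr_sumr -rmorph_sum.
  rewrite -/U rmorphM fmorphV /= conjC_nat.
  by field.
by apply: sumr_ge0 => y _; exact: mul_conjC_ge0.
Qed.

Lemma real_curvature_bound (b : nat) :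
  (d%:R * (1 - 2 / b%:R))%:C%C = d%:R * (1 - 2 / b%:R) :> R[i].
Proof. by rewrite !(rmorphM, rmorphB, fmorphV) /= !rmorph_nat rmorph1. Qed.

(** With no edges both quadratic forms vanish. This case is separate because
completing the squares divides by [d]. *)
Lemma CD_at_degree0 x K : d = 0%N -> CD_at e s K x.
Proof.
move=> d0 f; have no_nbr y : e x y = false.
  apply: contra_eqF (e_reg x) => exy.
  by rewrite d0 cards_eq0; apply/set0Pn; exists y; rewrite inE.
have G0 g h : Gamma e s g h x = 0 by rewrite (GammaE s_pot) big_pred0 ?mul0r.
rewrite /Gamma2 !G0 /laplacian /magnetic_laplacian big_pred0 //.
by rewrite oppr0 !addr0 mul0r mulr0.
Qed.

(** The bound [d * (1 - 2 / b)] controls the variance part of [Gamma f f x] and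
the bound [2] controls its mean part. *)
Lemma CD_of_common_neighbours (b : nat) x K : (0 < b)%N ->
  (forall z, z != x -> common_neighbours e x z != 0%N ->
     (b <= common_neighbours e x z)%N) ->
  K <= 2 -> K <= d%:R * (1 - 2 / b%:R) -> CD_at e s K x.
Proof.
move=> b0 hb K2 Kd.
have [d0|d0] := posnP d; first exact: CD_at_degree0.
move=> f.
rewrite -subr_ge0 -(pmulr_rge0 _ (ltr0n _ 4)) mulrBr (Gamma2_squares _ _ d0 b0).
rewrite (GammaE s_pot).
pose u y := f x - s x y * f y.
pose U := \sum_(y | e x y) u y.
have var0 := sum_nbr_variance x u d0; rewrite -/U in var0.
rewrite -/u; set N := \sum_(y | e x y) u y * (u y)^* in var0 *.
rewrite -/U; set S := \sum_(z | z != x) _.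
have S0 : 0 <= S.
  apply: sumr_ge0 => z zx.
  have [c0|cn0] := eqVneq (common_neighbours e x z) 0%N.
    by rewrite c0 (adjacency_star_lift_far _ _ c0) !(conjC0, mulr0, mul0r, addr0).
  rewrite square_completion // addr_ge0 // mulr_ge0 ?mul_conjC_ge0 //.
  by rewrite subr_ge0 ler_nat hb.
have dn0 : d%:R != 0 :> R[i] by rewrite pnatr_eq0 -lt0n.
set q := (f x - _) * _.
have q0 : 0 <= q by exact: mul_conjC_ge0.
(* [N] is split into its variance and mean parts, with separate slacks. *)
have -> : 2 * (d%:R * (1 - 2 / b%:R)) * (N - U * U^* / d%:R) +
    4 / d%:R * (U * U^*) + d%:R * (d%:R - 1) * q + S - 4 * (K%:C%C * (N / 2)) =
  2 * (d%:R * (1 - 2 / b%:R) - K%:C%C) * (N - U * U^* / d%:R) +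
  2 * (2 - K%:C%C) * (U * U^* / d%:R) + d%:R * (d%:R - 1) * q + S.
  have bn0 : b%:R != 0 :> R[i] by rewrite pnatr_eq0 -lt0n.
  by field; rewrite dn0 bn0.
have UU0 : 0 <= U * U^* := mul_conjC_ge0 U.
have Kd0 : 0 <= d%:R * (1 - 2 / b%:R) - K%:C%C :> R[i].
  by rewrite -real_curvature_bound subr_ge0 lecR.
have K20 : 0 <= 2 - K%:C%C :> R[i].
  by rewrite -(rmorph_nat (real_complex R) 2) subr_ge0 lecR.
have d10 : 0 <= d%:R - 1 :> R[i] by rewrite subr_ge0 ler1n.
apply: addr_ge0 => //; apply: addr_ge0; last by apply: mulr_ge0 => //; apply: mulr_ge0.
apply: addr_ge0; first by apply: mulr_ge0 => //; apply: mulr_ge0.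
by apply: mulr_ge0; [apply: mulr_ge0 | apply: divr_ge0].
Qed.

(** Every [u] is realised by some [f] that makes all completed squares vanish:
the value at [x] and those at distance two can be prescribed freely, and the
values at the neighbours are then determined by [u]. In the absence of triangles
the neighbours of [x] do not contribute to the last sum of [Gamma2_squares]. *)
Lemma optimal_extension (b : nat) x u
    (U := \sum_(y | e x y) u y)
    (N := \sum_(y | e x y) u y * (u y)^*) :
  (0 < d)%N -> (0 < b)%N ->
  (forall y, e x y -> common_neighbours e x y = 0%N) ->
  (forall z, z != x -> common_neighbours e x z != 0%N ->
     common_neighbours e x z = b) ->
  exists f, (forall y, e x y -> f x - s x y * f y = u y) /\
    4 * Gamma2 e s f f x =
    2 * (d%:R * (1 - 2 / b%:R)) * (N - U * U^* / d%:R) + 4 / d%:R * (U * U^*).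
Proof.
move=> d0 b0 no_triangle hb.
pose f z := if z == x then 2 / d%:R * U
            else if e x z then s z x * (2 / d%:R * U - u z)
            else - (2 / b%:R * T x u z).
have fu y : e x y -> f x - s x y * f y = u y.
  move=> exy; rewrite /f eqxx exy; case: eqVneq exy => [->|_ exy].
    by rewrite e_simple.2.
  by rewrite mulrA (potential_inv s_pot) // mul1r opprB addrC subrK.
have lu : star_lift e s x (fun y => f x - s x y * f y) = star_lift e s x u.
  by apply/funext => y; rewrite /star_lift; case: ifP => // /fu ->.
exists f; split=> //; rewrite (Gamma2_squares _ _ d0 b0) lu.
rewrite (eq_bigr u fu) -/U.
rewrite (eq_bigr (fun y => u y * (u y)^*)) => [|y /fu -> //]; rewrite -/N.
rewrite big1 => [|z zx]; last first.
  have [c0|cn0] := eqVneq (common_neighbours e x z) 0%N.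
    by rewrite c0 (adjacency_star_lift_far _ _ c0) !(conjC0, mulr0, mul0r, addr0).
  rewrite square_completion // hb // subrr mul0r add0r.
  rewrite {1}/f (negPf zx); case: ifP => [/no_triangle/eqP|_].
    by rewrite (negPf cn0).
  by rewrite addNr mul0r mulr0.
by rewrite {1 2}/f eqxx subrr mul0r mulr0 !addr0.
Qed.

(** The two bounds come from testing on the constant [u], whose variance is zero,
and on the difference of two point masses, whose mean is zero. *)
Lemma CD_upper_bound (b : nat) x K :
  (2 <= d)%N -> (0 < b)%N ->
  (forall y, e x y -> common_neighbours e x y = 0%N) ->
  (forall z, z != x -> common_neighbours e x z != 0%N ->
     common_neighbours e x z = b) ->
  CD_at e s K x -> K <= 2 /\ K <= d%:R * (1 - 2 / b%:R).
Proof.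
move=> d2 b0 no_triangle hb cdK.
have d0 : (0 < d)%N by exact: ltnW.
have dn0 : d%:R != 0 :> R[i] by rewrite pnatr_eq0 -lt0n.
have test u (U := \sum_(y | e x y) u y) (N := \sum_(y | e x y) u y * (u y)^*) :
    2 * K%:C%C * N <= 2 * (d%:R * (1 - 2 / b%:R)) * (N - U * U^* / d%:R)
                 + 4 / d%:R * (U * U^*).
  have [f [fu <-]] := optimal_extension u d0 b0 no_triangle hb.
  have -> : 2 * K%:C%C * N = 4 * (K%:C%C * Gamma e s f f x).
    rewrite (GammaE s_pot) (eq_bigr (fun y => u y * (u y)^*)) -/N; first by field.
    by move=> y /fu ->.
  by rewrite ler_pM2l ?ltr0n.
split.
  have := test (fun=> 1); rewrite !(sum_nbr_const e_reg) conjC1 !mulr1 /=.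
  rewrite conjC_nat mulfK // subrr mulr0 add0r -(lecR K).
  rewrite rmorph_nat -subr_ge0.
  have -> : 4 / d%:R * (d%:R * d%:R) - 2 * K%:C%C * d%:R =
            (2 * d%:R) * (2 - K%:C%C) by field.
  by rewrite pmulr_rge0 ?subr_ge0 // mulr_gt0 ?ltr0n.
have : (1 < #|[set y | e x y]%SET|)%N by rewrite e_reg.
case/card_gt1P=> y1 [y2 [ey1 ey2 y12]]; rewrite !inE in ey1 ey2.
pose u y : R[i] := (y == y1)%:R - (y == y2)%:R.
have := test u; rewrite /=.
have sum_at (F : V -> R[i]) : (forall y, y != y1 -> y != y2 -> F y = 0) ->
    \sum_(y | e x y) F y = F y1 + F y2.
  move=> F0; rewrite (bigD1 y1) //= (bigD1 y2) /= ?ey2 1?eq_sym // big1 ?addr0 //.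
  by move=> y /andP[/andP[_ h1] h2]; exact: F0.
have u0 y : y != y1 -> y != y2 -> u y = 0.
  by rewrite /u => /negPf -> /negPf ->; rewrite subrr.
have u1 : u y1 = 1 by rewrite /u eqxx (negPf y12) subr0.
have u2 : u y2 = -1 by rewrite /u eqxx eq_sym (negPf y12) sub0r.
rewrite !sum_at //; last by move=> y h1 h2; rewrite u0 // mul0r.
rewrite u1 u2 subrr !mul0r !mulr0 subr0 addr0 rmorphN /= conjC1 mulrNN !mulr1.
rewrite ler_pM2r ?addr_gt0 ?ltr01 // ler_pM2l ?ltr0n //.
by rewrite -real_curvature_bound lecR.
Qed.

End CurvatureBounds.

(** * Curvature of bipartite graphs *)

Section Curvature.
Variables (R : realType) (V : finType) (e : rel V) (s : V -> V -> R[i]).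
Variable d : nat.
Hypotheses (e_simple : simple_graph e) (e_reg : regular e d).
Hypotheses (e_bip : bipartite e) (s_pot : magnetic_potential e s).
Hypothesis s_sqr : adjacency_squares_to e s d.

Let e_sym : symmetric e := e_simple.1.

Lemma bipartite_triangle_free x y : e x y -> common_neighbours e x y = 0%N.
Proof.
have [c ce] := e_bip; move=> exy; apply/eqP; rewrite cards_eq0.
apply/eqP/setP => z; rewrite !inE; apply/negP => /andP[/ce + /ce].
by move: (ce _ _ exy); case: (c x); case: (c y); case: (c z).
Qed.

Lemma at_distance2 x z :
  z != x -> common_neighbours e x z != 0%N -> at_distance e 2 x z.
Proof.
move=> zx cz; split.
  move: cz; rewrite cards_eq0 => /set0Pn[y]; rewrite inE => /andP[exy ezy].
  by exists [:: y; z]; rewrite /= exy e_sym ezy.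
case=> [|[|n]] // _ [p []]; first by case: p => //= _ _ xz; rewrite xz eqxx in zx.
case: p => [|y [|//]] //= _; rewrite andbT => exy yz.
by rewrite -yz (bipartite_triangle_free exy) in cz.
Qed.

Lemma curvature_ge (b : nat) x : (0 < b)%N ->
  (forall z, at_distance e 2 x z -> (b <= common_neighbours e x z)%N) ->
  ((Num.min 2 (d%:R * (1 - 2 / b%:R)))%:E <= curvature e s x)%E.
Proof.
move=> b0 hb; apply: ereal_sup_ubound; exists (Num.min 2 (d%:R * (1 - 2 / b%:R))) => //.
apply: (CD_of_common_neighbours e_simple e_reg s_pot s_sqr b0).
- by move=> z zx cz; apply: hb; exact: at_distance2.
- by rewrite ge_min lexx.
- by rewrite ge_min lexx orbT.
Qed.

Lemma curvature_eq (b : nat) x : (2 <= d)%N -> (0 < b)%N ->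
  (forall z, at_distance e 2 x z -> common_neighbours e x z = b) ->
  curvature e s x = (Num.min 2 (d%:R * (1 - 2 / b%:R)))%:E.
Proof.
move=> d2 b0 hb; apply/eqP; rewrite eq_le curvature_ge // ?andbT; last first.
  by move=> z /hb ->.
apply: ge_ereal_sup => _ [K cdK <-]; rewrite lee_fin le_min.
have hb' z : z != x -> common_neighbours e x z != 0%N -> common_neighbours e x z = b.
  by move=> zx cz; apply: hb; exact: at_distance2.
have [] := CD_upper_bound e_simple e_reg s_pot s_sqr d2 b0 _ hb' cdK.
  exact: bipartite_triangle_free.
by move=> -> ->.
Qed.

Lemma CD0_of_adjacency_sqr : CD e s 0.
Proof.
move=> x.
apply: (CD_of_common_neighbours e_simple e_reg s_pot s_sqr (b := 2)) => //.
  by move=> z; exact: (common_neighbours_ge2 e_simple s_pot s_sqr).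
by rewrite divff ?pnatr_eq0 // subrr mulr0.
Qed.

Lemma curvature_eq0 x : (2 <= d)%N ->
  (forall z, at_distance e 2 x z -> common_neighbours e x z = 2%N) ->
  curvature e s x = 0%:E.
Proof.
move=> d2 hx; rewrite (curvature_eq d2 _ hx) // divff ?pnatr_eq0 //.
by rewrite subrr mulr0 min_r.
Qed.

Lemma curvature_gt0 (b : nat) x : (3 <= b)%N ->
  (forall z, at_distance e 2 x z -> (b <= common_neighbours e x z)%N) ->
  (0%:E < curvature e s x)%E.
Proof.
move=> b3 hb; have b0 : (0 < b)%N by exact: leq_trans b3.
have [d0|d0] := posnP d; last first.
  apply: lt_le_trans (curvature_ge b0 hb); rewrite lte_fin lt_min ltr0n /=.
  rewrite mulr_gt0 ?ltr0n // subr_gt0 ltr_pdivrMr ?ltr0n // mul1r.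
  by rewrite ltr_nat.
apply: (@lt_le_trans _ _ 1%:E); first by rewrite lte_fin ltr01.
apply: ereal_sup_ubound; exists 1 => //.
exact: (CD_at_degree0 e_reg s_pot).
Qed.

End Curvature.

(** * Spectral characterisation of adjacency operators squaring to the degree *)

Section Spectral.

(** The squares of the eigenvalues are at most [c] and have mean [c], so each of
them is [c]; the conclusion follows as [M] is diagonalisable. *)
Lemma hermitian_sqr_scalar (C : numClosedFieldType) n (M : 'M[C]_n) (c : C) :
  M \is hermsymmx ->
  (forall a, a \is Num.real -> eigenvalue M a -> a ^+ 2 <= c) ->
  \tr (M *m M) = c *+ n -> M *m M = c%:M.
Proof.
move=> Mh eigM trM.
set P := spectralmx M; set D := spectral_diag M.
have Pu : P \in unitmx by exact: spectral_unit.
have ME : M = invmx P *m diag_mx D *m P.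
  exact/orthomx_spectralP/hermitian_normalmx.
have M2E : M *m M = invmx P *m (diag_mx D *m diag_mx D) *m P.
  by rewrite {1 2}ME !mulmxA mulmxK.
have D2 : diag_mx D *m diag_mx D = diag_mx (\row_i D 0 i ^+ 2).
  by rewrite mulmx_diag; congr diag_mx; apply/rowP => i; rewrite !mxE expr2.
have Dle i : 0 <= c - D 0 i ^+ 2.
  rewrite subr_ge0; apply: eigM.
    by have /mxOverP := hermitian_spectral_diag_real Mh; apply.
  apply/eigenvalueP; exists (row i P).
    rewrite -row_mul {1}ME !mulmxA mulmxV // mul1mx row_mul.
    by rewrite row_diag_mx -scalemxAl -rowE.
  apply/eqP => /(congr1 (mulmx^~ (invmx P))); rewrite -row_mul mulmxV // mul0mx.
  by move/rowP/(_ i)/eqP; rewrite !mxE eqxx oner_eq0.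
have Dsum : \sum_i (c - D 0 i ^+ 2) = 0.
  rewrite sumrB sumr_const card_ord -trM M2E D2 mxtrace_mulC mulmxA.
  rewrite mulmxV // mul1mx mxtrace_diag.
  by apply/eqP; rewrite subr_eq0; apply/eqP/eq_bigr => i _; rewrite mxE.
have Dc i : D 0 i ^+ 2 = c.
  apply/esym/eqP; rewrite -subr_eq0.
  by have /psumr_eq0P -> := Dsum.
rewrite M2E D2.
have -> : \row_i D 0 i ^+ 2 = const_mx c by apply/rowP => i; rewrite !mxE Dc.
by rewrite diag_const_mx mul_mx_scalar -scalemxAl mulVmx // scalemx1.
Qed.

Variables (R : realType) (V : finType) (e : rel V) (s : V -> V -> R[i]).
Variable d : nat.
Hypotheses (e_simple : simple_graph e) (e_reg : regular e d).
Hypotheses (s_pot : magnetic_potential e s).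
Local Notation A := (magnetic_adjacency e s).

Let e_sym : symmetric e := e_simple.1.

(** Transposed, because matrices act on row vectors from the right. *)
Definition adjacency_mx : 'M[R[i]]_#|V| :=
  \matrix_(i, j) (if e (enum_val j) (enum_val i)
                  then s (enum_val j) (enum_val i) else 0).

Lemma mul_adjacency_mx (r : 'rV[R[i]]_#|V|) j :
  (r *m adjacency_mx) 0 j = A (fun x => r 0 (enum_rank x)) (enum_val j).
Proof.
rewrite mxE /magnetic_adjacency [RHS]big_mkcond /=.
rewrite [RHS](reindex (@enum_val _ V)) /=; last exact/onW_bij/enum_val_bij.
apply: eq_bigr => i _; rewrite mxE enum_valK.
by case: ifP => _; rewrite ?mulr0 // mulrC.
Qed.

Lemma adjacency_mx_herm : adjacency_mx \is hermsymmx.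
Proof.
apply/is_hermitianmxP; rewrite expr0 scale1r; apply/matrixP => i j.
rewrite !mxE [e (enum_val i) _]e_sym; case: ifP => eij; last by rewrite conjC0.
by rewrite (potential_conj s_pot) // e_sym.
Qed.

Lemma adjacency_mx_tr : \tr (adjacency_mx *m adjacency_mx) = d%:R *+ #|V|.
Proof.
have -> : d%:R *+ #|V| = \sum_(i < #|V|) d%:R :> R[i].
  by rewrite sumr_const card_ord.
apply: eq_bigr => i _; rewrite mxE -[RHS]mulr1 -(sum_nbr_const e_reg (enum_val i)).
rewrite [RHS]big_mkcond /= [RHS](reindex (@enum_val _ V)) /=; last first.
  exact/onW_bij/enum_val_bij.
apply: eq_bigr => j _; rewrite !mxE [e (enum_val j) _]e_sym.
by case: ifP => [eij|_]; rewrite ?mulr0 // (potential_inv s_pot) // e_sym.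
Qed.

Lemma laplacian_eigenvalueE (t : R) : laplacian_eigenvalue e s t%:C%C <->
  exists f, (exists x, f x != 0) /\ forall x, A f x = (d%:R - t)%:C%C * f x.
Proof.
split=> -[f [f0 Lf]]; exists f; split=> // x; have := Lf x;
  rewrite (laplacian_adjacency _ e_reg) rmorphB /= rmorph_nat mulrBl.
  by move=> <-; rewrite opprB addrC subrK.
by move=> ->; rewrite opprB addrC subrK.
Qed.

(** Evaluating the eigenvalue equation where [|f|] is maximal bounds [|d - t|]
by [d]. Nonnegativity provides the lower bound that makes the infimum in
[lambda1] meaningful. *)
Lemma laplacian_eigenvalue_ge0 (t : R) :
  laplacian_eigenvalue e s t%:C%C -> 0 <= t.
Proof.
move=> /laplacian_eigenvalueE[f [[x0 fx0] Af]].
have normR z : (complex.Re `|f z|)%:C%C = `|f z| by rewrite RRe_real ?normr_real.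
case: (@arg_maxP _ _ _ x0 xpredT (fun z => complex.Re `|f z|)) => // x _ xmax.
have le_x z : `|f z| <= `|f x|.
  have : complex.Re `|f z| <= complex.Re `|f x| by exact: xmax.
  by rewrite -lecR !normR.
have fx_gt0 : 0 < `|f x| by apply: lt_le_trans (le_x x0); rewrite normr_gt0.
have : `|(d%:R - t)%:C%C| * `|f x| <= d%:R * `|f x|.
  rewrite -normrM -Af -(sum_nbr_const e_reg x).
  apply: le_trans (ler_norm_sum _ _ _) _; apply: ler_sum => y exy.
  by rewrite normrM (s_pot exy).1 mul1r.
rewrite ler_pM2r // => /(le_trans (real_ler_norm _)).
rewrite -(rmorph_nat (real_complex R)) lecR => h.
have : d%:R - t <= d%:R by apply: h; apply/complex_realP; exists (d%:R - t).
by rewrite gerBl.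
Qed.

Lemma lambda1_le_eigenvalue (t : R) :
  laplacian_eigenvalue e s t%:C%C -> lambda1 e s <= t.
Proof.
by apply: ge_inf; exists 0 => u; exact: laplacian_eigenvalue_ge0.
Qed.

(** Flipping the sign of an eigenfunction on one colour class negates its
eigenvalue, so the upper bound [sqrt d] on the eigenvalues of [A] is also a
bound on their absolute values, and the trace argument applies. *)
Lemma adjacency_sqr_of_lambda1 : bipartite e -> d%:R - Num.sqrt d%:R <= lambda1 e s ->
  adjacency_squares_to e s d.
Proof.
move=> [c ce] lam.
have le_sqrt f (a : R) : (exists x, f x != 0) ->
    (forall x, A f x = a%:C%C * f x) -> a <= Num.sqrt d%:R.
  move=> f0 Af; rewrite -[leLHS](subKr d%:R) lerBlDl -lerBlDr.
  apply: le_trans lam (lambda1_le_eigenvalue _); apply/laplacian_eigenvalueE.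
  by exists f; split=> // x; rewrite subKr.
have M2 : adjacency_mx *m adjacency_mx = d%:R%:M.
  apply: hermitian_sqr_scalar adjacency_mx_herm _ adjacency_mx_tr.
  move=> _ /complex_realP[a ->] /eigenvalueP[r rM r0].
  pose f x := r 0 (enum_rank x).
  have f0 : exists x, f x != 0.
    have /rV0Pn[j rj] := r0; exists (enum_val j).
    by rewrite /f enum_valK.
  have Af x : A f x = a%:C%C * f x.
    by rewrite -{1}[x]enum_rankK -mul_adjacency_mx rM mxE.
  have a_le : a <= Num.sqrt d%:R by exact: le_sqrt Af.
  have Na_le : - a <= Num.sqrt d%:R.
    apply: (le_sqrt (fun x => (-1) ^+ c x * f x)).
      by have [x fx] := f0; exists x; rewrite mulf_neq0 ?signr_eq0.
    move=> x; rewrite mulrCA rmorphN mulNr -Af mulrN -mulNr mulr_sumr.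
    apply: eq_bigr => y exy.
    by move: (ce _ _ exy); case: (c x); case: (c y) => // _; ring.
  rewrite -rmorphXn -(rmorph_nat (real_complex R)) lecR -real_normK ?num_real //.
  rewrite -[leRHS](@sqr_sqrtr R) ?ler0n // lerXn2r ?nnegrE ?sqrtr_ge0 //.
  by rewrite ler_norml lerNl Na_le.
move=> f x; pose r : 'rV[R[i]]_#|V| := \row_i f (enum_val i).
have := congr1 (fun M => (r *m M) 0 (enum_rank x)) M2.
rewrite mulmxA mul_adjacency_mx enum_rankK mul_mx_scalar !mxE enum_rankK => <-.
congr (A _ x); apply/funext => y; rewrite mul_adjacency_mx enum_rankK.
by congr (A _ y); apply/funext => z; rewrite mxE enum_rankK.
Qed.

(** All eigenvalues of [A] are square roots of [d], and [sqrt d] is one of them: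
for any [g], [A] multiplies the function [A g + sqrt d * g] by [sqrt d]. With
[g] the point mass at [x], its value at [x] is [sqrt d], which is nonzero. *)
Lemma lambda1_of_adjacency_sqr (x : V) : (0 < d)%N ->
  adjacency_squares_to e s d ->
  lambda1 e s = d%:R - Num.sqrt d%:R.
Proof.
move=> d0 sqr.
have sqr_sqrt : (Num.sqrt d%:R)%:C%C * (Num.sqrt d%:R)%:C%C = d%:R :> R[i].
  by rewrite -rmorphM -expr2 sqr_sqrtr ?ler0n // rmorph_nat.
have eig : laplacian_eigenvalue e s (d%:R - Num.sqrt d%:R)%:C%C.
  apply/laplacian_eigenvalueE; rewrite subKr.
  pose g y : R[i] := (y == x)%:R.
  exists (fun y => A g y + (Num.sqrt d%:R)%:C%C * g y); split.
    exists x; rewrite /g eqxx mulr1 /magnetic_adjacency big1 ?add0r.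
      by rewrite fmorph_eq0 sqrtr_eq0 -ltNge ltr0n.
    move=> y exy; case: eqVneq exy => [->|_ _]; last by rewrite mulr0.
    by rewrite e_simple.2.
  move=> y; rewrite mulrDr mulrA sqr_sqrt -sqr {1}/magnetic_adjacency addrC.
  under eq_bigr do rewrite mulrDr mulrCA.
  by rewrite big_split /= -mulr_sumr addrC.
apply/eqP; rewrite eq_le lambda1_le_eigenvalue //=.
apply: lb_le_inf; first by exists (d%:R - Num.sqrt d%:R).
move=> t /laplacian_eigenvalueE[f [[z fz] Af]].
rewrite lerBlDr -lerBlDl.
have sqr_dt : (d%:R - t) ^+ 2 = d%:R.
  apply: complexI; rewrite rmorph_nat rmorphXn expr2.
  apply: (mulIf fz); rewrite -mulrA -!Af -sqr mulr_sumr.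
  by apply: eq_bigr => y _; rewrite Af mulrCA.
by apply: le_trans (ler_norm _) _; rewrite -sqrtr_sqr sqr_dt.
Qed.

End Spectral.

(** * Squares of maximal adjacency operators *)

Section Maximal.
Variables (R : realType) (V : finType) (e : rel V) (d : nat).
Hypotheses (e_simple : simple_graph e) (e_reg : regular e d).
Hypothesis e_bip : bipartite e.

Lemma lambda1_le (x : V) (s : V -> V -> R[i]) : (0 < d)%N ->
  magnetic_potential e s -> lambda1 e s <= d%:R - Num.sqrt d%:R.
Proof.
move=> d0 s_pot; rewrite leNgt; apply/negP => lam.
have sqr := adjacency_sqr_of_lambda1 e_simple e_reg s_pot e_bip (ltW lam).
by rewrite (lambda1_of_adjacency_sqr e_simple e_reg s_pot x d0 sqr) ltxx in lam.
Qed.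

(** The potential [s0] shows that the height is at least [d - sqrt d]: by
[lambda1_le] it is the supremum of a bounded set, so it dominates
[lambda1 e s0]. *)
Lemma maximal_adjacency_sqr (x : V) (s0 s : V -> V -> R[i]) : (0 < d)%N ->
  magnetic_potential e s0 ->
  adjacency_squares_to e s0 d ->
  maximal_potential e s ->
  adjacency_squares_to e s d.
Proof.
move=> d0 s0_pot s0_sqr [s_pot s_max].
apply: (adjacency_sqr_of_lambda1 e_simple e_reg s_pot e_bip); rewrite s_max.
rewrite -(lambda1_of_adjacency_sqr e_simple e_reg s0_pot x d0 s0_sqr).
apply: ub_le_sup; last by exists s0.
exists (d%:R - Num.sqrt d%:R) => _ [s' s'_pot <-].
exact: lambda1_le.
Qed.

End Maximal.

(** * Hypercubes *)

Section Hypercube.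
Variables (R : realType) (d : nat).
Local Notation V := {ffun 'I_d -> bool}.
Implicit Types (u v x y z : V) (i j k : 'I_d).

Definition flip i u : V := [ffun j => (j == i) (+) u j].

Lemma flipK i : involutive (flip i).
Proof. by move=> u; apply/ffunP => j; rewrite !ffunE addbA addbb. Qed.

Lemma flipC i j u : flip i (flip j u) = flip j (flip i u).
Proof. by apply/ffunP => k; rewrite !ffunE addbCA. Qed.

Lemma flip_inj u : injective (flip^~ u).
Proof.
move=> i j /ffunP/(_ i); rewrite !ffunE eqxx.
by case: eqVneq => // _; case: (u i).
Qed.

Lemma hypercubeP u v : reflect (exists i, v = flip i u) (hypercube d u v).
Proof.
apply: (iffP existsP) => [[i /andP[uvi /forallP uv]]|[i ->]].
  exists i; apply/ffunP => j; rewrite ffunE; have := uv j.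
  case: eqVneq => [->|_ /eqP -> //] _.
  by move: uvi; rewrite /complete_graph; case: (u i); case: (v i).
exists i; rewrite /complete_graph ffunE eqxx; apply/andP; split.
  by case: (u i).
by apply/forallP => j; apply/implyP => /negPf ji; rewrite ffunE ji.
Qed.

Lemma hypercube_simple : simple_graph (hypercube d).
Proof.
split=> [u v|u].
  by apply/hypercubeP/hypercubeP => -[i ->]; exists i; rewrite flipK.
apply/hypercubeP; case=> i /ffunP/(_ i); rewrite ffunE eqxx.
by case: (u i).
Qed.

Lemma hypercube_nbrs u : [set v | hypercube d u v]%SET = [set flip i u | i in 'I_d]%SET.
Proof.
apply/setP => v; rewrite inE; apply/hypercubeP/imsetP => [[i ->]|[i _ ->]];
  by exists i.
Qed.

Lemma hypercube_regular : regular (hypercube d) d.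
Proof.
move=> u; rewrite hypercube_nbrs card_imset ?card_ord //; exact: flip_inj.
Qed.

Lemma hypercube_bipartite : bipartite (hypercube d).
Proof.
exists (fun u => \big[addb/false]_i u i) => u v /hypercubeP[i ->].
rewrite (bigD1 i) //= [X in _ != X](bigD1 i) //= ffunE eqxx.
rewrite [X in _ != _ (+) X](eq_bigr u) => [|j /negPf ji]; last by rewrite ffunE ji.
by case: (u i); case: (\big[_/_]_(_ | _) _).
Qed.

(** If [z] differs from [x] in the coordinates [i] and [j], the common neighbours
are the two vertices obtained by flipping one of them. *)
Lemma hypercube_common x z :
  at_distance (hypercube d) 2 x z -> common_neighbours (hypercube d) x z = 2%N.
Proof.
move=> [[p [sz_p path_p last_p]] nowalk].
case: p sz_p path_p last_p => [|y [|t [|]]] // _; rewrite /path /last.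
case/and3P => /hypercubeP[i ->] /hypercubeP[j ->] _ zE; rewrite -{z}zE in nowalk *.
have ij : i != j.
  apply/eqP => ij; apply: (nowalk 0%N isT); exists [::]; split=> //=.
  by rewrite ij flipK.
rewrite /common_neighbours.
have -> : [set y | hypercube d x y && hypercube d (flip j (flip i x)) y]%SET =
          [set flip i x; flip j x]%SET.
  apply/setP => w; rewrite !inE; apply/andP/orP => [[/hypercubeP[k ->]]|].
    case/hypercubeP=> l /ffunP kl.
    have [->|ki] := eqVneq k i; first by left.
    have [->|kj] := eqVneq k j; first by right.
    have := kl k; have := kl i; rewrite !ffunE !eqxx (negPf ki) (negPf kj) (negPf ij).
    rewrite [i == k]eq_sym (negPf ki).
    have [<-|_] := eqVneq k l; last by case: (x k).
    by rewrite [i == k]eq_sym (negPf ki); case: (x i).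
  by case=> /eqP ->; split; apply/hypercubeP;
    [exists i | exists j; rewrite flipK | exists j | exists i; rewrite flipC flipK].
by rewrite cards2 (inj_eq (@flip_inj x)) ij.
Qed.

(** The sign of the edge in direction [i] at [u] is the parity of the coordinates
before [i]. With these signs the [d] signed flips anticommute pairwise. *)
Definition cube_sign i u : R[i] := \prod_(j < d | (j < i)%N) (-1) ^+ u j.

(** The direction of an edge is recovered as the coordinate where its ends
differ. *)
Definition cube_potential u v : R[i] :=
  if [pick i | u i != v i] is Some i then cube_sign i u else 1.

Lemma cube_potential_flip i u : cube_potential u (flip i u) = cube_sign i u.
Proof.
rewrite /cube_potential; case: pickP => [j|/(_ i)]; rewrite ffunE.
  by case: (eqVneq j i) => [-> //|_]; case: (u j).
by rewrite eqxx; case: (u i).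
Qed.

Lemma cube_sign_flip i j u :
  cube_sign j (flip i u) = (-1) ^+ (i < j)%N * cube_sign j u.
Proof.
rewrite /cube_sign; case: ltnP => ij.
  rewrite (bigD1 i) //= [in RHS](bigD1 i) //= ffunE eqxx mulrA; congr (_ * _).
    by case: (u i); rewrite /= ?expr0 ?expr1 ?mulrNN !mulr1.
  by apply: eq_bigr => k /andP[_ /negPf ki]; rewrite ffunE ki.
rewrite mul1r; apply: eq_bigr => k kj; rewrite ffunE.
by case: eqVneq kj => // -> /leq_trans/(_ ij); rewrite ltnn.
Qed.

Lemma cube_sign_sqr i u : cube_sign i u * cube_sign i u = 1.
Proof. by rewrite -big_split big1 //= => j _; rewrite -signr_addb addbb. Qed.

Lemma cube_sign_norm i u : `|cube_sign i u| = 1.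
Proof. by rewrite normr_prod big1 // => j _; rewrite normr_sign. Qed.

Lemma cube_potentialP : magnetic_potential (hypercube d) cube_potential.
Proof.
move=> u v /hypercubeP[i ->]; have := cube_potential_flip i (flip i u).
rewrite flipK cube_potential_flip => ->.
rewrite cube_sign_flip ltnn mul1r cube_sign_norm; split=> //.
have s0 : cube_sign i u != 0 by rewrite -normr_eq0 cube_sign_norm oner_eq0.
by apply: (mulfI s0); rewrite cube_sign_sqr divff.
Qed.

Lemma cube_adjacency f u :
  magnetic_adjacency (hypercube d) cube_potential f u =
  \sum_i cube_sign i u * f (flip i u).
Proof.
rewrite /magnetic_adjacency -big_set hypercube_nbrs big_imset /=; last first.
  by move=> i j _ _; exact: flip_inj.
by apply: eq_bigr => i _; rewrite cube_potential_flip.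
Qed.

(** The two paths around each square of the cube have opposite signs, so in [A^2]
only the walks that go back and forth along an edge survive. *)
Lemma cube_adjacency_sqr : adjacency_squares_to (hypercube d) cube_potential d.
Proof.
move=> f u; rewrite cube_adjacency; under eq_bigr do rewrite cube_adjacency mulr_sumr.
pose F i j := cube_sign i u * (cube_sign j (flip i u) * f (flip j (flip i u))).
have Fsym i j : F i j + F j i = (i == j)%:R * (2 * f u).
  rewrite /F !cube_sign_flip [flip i (flip j u)]flipC.
  have [->|ij] := eqVneq i j.
    rewrite flipK ltnn expr0 !mul1r mulrA cube_sign_sqr mul1r.
    by rewrite mulr2n mulrDl !mul1r.
  rewrite mul0r; case: ltngtP ij => [ij|ji|/val_inj -> /eqP //] _;
    by rewrite expr0 expr1; ring.
(* The double sum is compared with its transpose, hence the factor [2]. *)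
apply: (@mulfI _ 2); first by rewrite pnatr_eq0.
transitivity (\sum_i \sum_j (F i j + F j i)).
  under [RHS]eq_bigr do rewrite big_split.
  by rewrite big_split /= [X in _ + X]exchange_big /= mulr2n mulrDl mul1r.
transitivity (\sum_(i < d) 2 * f u); last by rewrite sumr_const card_ord -mulr_natl; ring.
apply: eq_bigr => i _; rewrite (bigD1 i) //= Fsym eqxx mul1r big1 ?addr0 //.
by move=> j; rewrite Fsym eq_sym => /negPf ->; rewrite mul0r.
Qed.

End Hypercube.

(** * Complete bipartite graphs *)

Section CompleteBipartite.
Variables (R : realType) (d : nat).
Hypothesis d_gt0 : (0 < d)%N.
Local Notation V := ('I_d + 'I_d)%type.
Local Notation K := (complete_bipartite d d).

Lemma complete_bipartite_simple : simple_graph K.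
Proof. by split=> [[i|i] [j|j]|[i|i]]. Qed.

Lemma complete_bipartite_bipartite : bipartite K.
Proof. by exists (fun x => if x is inl _ then true else false) => -[i|i] [j|j]. Qed.

Lemma complete_bipartite_regular : regular K d.
Proof.
move=> x; rewrite -sum1dep_card big_sumType /=.
by case: x => i /=; rewrite big_pred0_eq sum1_card card_ord ?addn0.
Qed.

(** Vertices at distance two lie on the same side, and hence have the same
neighbours. *)
Lemma complete_bipartite_common x z :
  at_distance K 2 x z -> common_neighbours K x z = d.
Proof.
move=> [_ nowalk]; rewrite -[RHS](complete_bipartite_regular x).
have {nowalk} : ~~ K x z.
  by apply/negP => xz; apply: (nowalk 1%N isT); exists [:: z]; rewrite /= xz.
case: x z => i [j|j] //= _; apply: eq_card => -[k|k]; by rewrite !inE.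
Qed.

(** In characteristic zero ['X^n - 1] splits into distinct linear factors, and
the group of its [n] roots is cyclic. *)
Lemma prim_root_exists (C : numClosedFieldType) n : (n > 0)%N ->
  exists w : C, n.-primitive_root w.
Proof.
move=> n_gt0.
have [r] := closed_field_poly_normal ('X^n - 1 : {poly C}).
rewrite (monicP (monicXnsubC _ n_gt0)) scale1r => XnE.
suff /hasP[w _ w_prim] : has n.-primitive_root r by exists w.
apply: has_prim_root => //.
- by apply/allP => w; rewrite -root_prod_XsubC -XnE.
- by rewrite -separable_prod_XsubC -XnE separable_Xn_sub_1 // pnatr_eq0 -lt0n.
- by rewrite -ltnS -(size_prod_XsubC r id) -XnE size_XnsubC.
Qed.

Variable w : R[i].
Hypothesis w_prim : d.-primitive_root w.

Definition fourier_potential (x y : V) : R[i] :=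
  match x, y with
  | inl j, inr k => w ^+ (j * k)
  | inr k, inl j => w ^- (j * k)
  | _, _ => 1
  end.

Lemma prim_root_neq0 : w != 0.
Proof.
apply/eqP => w0; have := prim_expr_order w_prim.
by rewrite w0 expr0n eqn0Ngt d_gt0 => /eqP; rewrite eq_sym oner_eq0.
Qed.

Lemma prim_root_norm : `|w| = 1.
Proof.
apply/eqP; rewrite -(@pexpr_eq1 _ _ d) ?normr_ge0 // -normrX.
by rewrite (prim_expr_order w_prim) normr1.
Qed.

Lemma fourier_potentialP : magnetic_potential K fourier_potential.
Proof.
by move=> [i|i] [j|j] //= _; rewrite ?invrK ?normfV normrX prim_root_norm expr1n ?invr1.
Qed.

Lemma fourier_orthogonality (i j : 'I_d) :
  \sum_(k < d) (w ^+ i / w ^+ j) ^+ k = d%:R * (i == j)%:R.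
Proof.
have wj0 : w ^+ j != 0 by rewrite expf_neq0 ?prim_root_neq0.
have [->|ij] := eqVneq i j.
  rewrite divff // (eq_bigr (fun=> 1)) => [|k _]; last by rewrite expr1n.
  by rewrite sumr_const card_ord mulr1.
rewrite mulr0; set q := _ / _.
have q1 : q - 1 != 0.
  rewrite subr_eq0 -(inj_eq (mulIf wj0)) mul1r divfK //.
  by rewrite (eq_prim_root_expr w_prim) !modn_small.
apply: (mulfI q1); rewrite -subrX1 expr_div_n -!exprM ![(_ * d)%N]mulnC !exprM.
by rewrite (prim_expr_order w_prim) !expr1n divff ?oner_eq0 // subrr mulr0.
Qed.

(** The two off-diagonal blocks of [A] are the Fourier matrix of order [d] and
its adjoint, and their products are [d] times the identity. *)
Lemma fourier_adjacency_sqr : adjacency_squares_to K fourier_potential d.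
Proof.
move=> f x.
have AL g i : magnetic_adjacency K fourier_potential g (inl i) =
              \sum_(k < d) w ^+ (i * k) * g (inr k).
  by rewrite /magnetic_adjacency big_sumType /= big_pred0_eq add0r.
have AR g k : magnetic_adjacency K fourier_potential g (inr k) =
              \sum_(i < d) w ^- (i * k) * g (inl i).
  by rewrite /magnetic_adjacency big_sumType /= big_pred0_eq addr0.
have orth (i : 'I_d) (g : 'I_d -> R[i]) :
    \sum_(l < d) d%:R * (i == l)%:R * g l = d%:R * g i.
  rewrite (bigD1 i) //= eqxx mulr1 big1 ?addr0 // => l.
  by rewrite eq_sym => /negPf ->; rewrite mulr0 mul0r.
case: x => i; rewrite ?AL ?AR.
  rewrite -(orth i (fun l => f (inl l))).
  under eq_bigr do rewrite AR mulr_sumr.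
  rewrite exchange_big; apply: eq_bigr => l _.
  rewrite -fourier_orthogonality mulr_suml; apply: eq_bigr => k _.
  by rewrite mulrA expr_div_n -!exprM.
rewrite -(orth i (fun l => f (inr l))).
under eq_bigr do rewrite AL mulr_sumr.
rewrite exchange_big; apply: eq_bigr => l _.
rewrite eq_sym -fourier_orthogonality mulr_suml; apply: eq_bigr => k _.
by rewrite mulrA expr_div_n -!exprM ![(k * _)%N]mulnC [w ^- _ * _]mulrC.
Qed.

End CompleteBipartite.

(** * Curvature of maximal potentials *)

Theorem theorem3p18 (R : realType) :
  (forall (d : nat) (V : finType) (e : rel V) (s : V -> V -> R[i]),
     simple_graph e -> regular e d -> bipartite e ->
     magneto_spectral_height R e = d%:R - Num.sqrt d%:R ->
     maximal_potential e s ->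
     [/\ CD e s 0,
         (2 <= d)%N ->
         forall x : V,
           (forall z, at_distance e 2 x z -> common_neighbours e x z = 2%N) ->
           curvature e s x = 0%:E
       & forall (x : V) (b : nat), (3 <= b)%N ->
           ((forall z, at_distance e 2 x z -> (b <= common_neighbours e x z)%N) ->
              (0%:E < curvature e s x)%E /\
              ((Num.min 2 (d%:R * (1 - 2 / b%:R)))%:E <= curvature e s x)%E) /\
           ((2 <= d)%N ->
            (forall z, at_distance e 2 x z -> common_neighbours e x z = b) ->
              curvature e s x = (Num.min 2 (d%:R * (1 - 2 / b%:R)))%:E)]) /\
  (forall (d : nat) (s : {ffun 'I_d -> bool} -> {ffun 'I_d -> bool} -> R[i]),
     (2 <= d)%N -> maximal_potential (hypercube d) s ->
     forall x, curvature (hypercube d) s x = 0%:E) /\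
  (forall (d : nat) (s : 'I_d + 'I_d -> 'I_d + 'I_d -> R[i]),
     (3 <= d)%N -> maximal_potential (complete_bipartite d d) s ->
     forall x, curvature (complete_bipartite d d) s x =
               (if d == 3%N then 1 else 2)%:E).
Proof.
split; [|split].
- move=> d V e s e_simple e_reg e_bip nu [s_pot s_max].
  have s_sqr : adjacency_squares_to e s d.
    by apply: adjacency_sqr_of_lambda1 => //; rewrite s_max nu.
  split.
  + exact: (CD0_of_adjacency_sqr e_simple e_reg s_pot s_sqr).
  + by move=> d2 x; exact: (curvature_eq0 e_simple e_reg e_bip s_pot s_sqr).
  + move=> x b b3; have b0 : (0 < b)%N by exact: leq_trans b3.
    split=> [hb|d2 hb]; last by apply: curvature_eq.
    by split; [apply: curvature_gt0 b3 hb | apply: curvature_ge].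
- move=> d s d2 s_max x.
  have s_sqr : adjacency_squares_to (hypercube d) s d.
    apply: (maximal_adjacency_sqr _ _ _ x _ _ _ s_max); last 1 first.
    + exact: cube_adjacency_sqr.
    + exact: hypercube_simple.
    + exact: hypercube_regular.
    + exact: hypercube_bipartite.
    + exact: ltnW.
    + exact: cube_potentialP.
  apply: (curvature_eq0 _ _ _ _ s_sqr d2).
  + exact: hypercube_simple.
  + exact: hypercube_regular.
  + exact: hypercube_bipartite.
  + exact: s_max.1.
  + exact: hypercube_common.
- move=> d s d3 s_max x; have d0 : (0 < d)%N by exact: leq_trans d3.
  have [w w_prim] := prim_root_exists R[i] d0.
  have s_sqr : adjacency_squares_to (complete_bipartite d d) s d.
    apply: (maximal_adjacency_sqr _ _ _ x d0 _ _ s_max); last 1 first.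
    + exact: (fourier_adjacency_sqr d0 w_prim).
    + exact: complete_bipartite_simple.
    + exact: complete_bipartite_regular.
    + exact: complete_bipartite_bipartite.
    + exact: fourier_potentialP.
  rewrite (curvature_eq (complete_bipartite_simple d) (@complete_bipartite_regular d)
    (complete_bipartite_bipartite d) s_max.1 s_sqr (ltnW d3) d0
    (@complete_bipartite_common d x)).
  have dn0 : d%:R != 0 :> R by rewrite pnatr_eq0 -lt0n.
  have -> : d%:R * (1 - 2 / d%:R) = d%:R - 2 :> R by field.
  case: eqVneq => [->|dn3]; first by rewrite -natrB // min_r // ler_nat.
  have d4 : (4 <= d)%N by rewrite ltn_neqAle eq_sym dn3.
  by rewrite min_l // lerBrDr -natrD ler_nat.
Qed.
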